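(* Let $G$ be a rayless graph (possibly infinite) such that the set of induced subgraphs of $G$ is labelled well-quasi-ordered. Then $G$ has the Erdős–Pósa property: there is a function $f:\mathbb N\to\mathbb N$ such that for every graph $\Gamma$ (possibly infinite) and every $k\in\mathbb N$, either $\Gamma$ contains $k$ pairwise disjoint subgraphs isomorphic to $G$, or there is a set $X\subseteq V(\Gamma)$ with $|X|\le f(k)$ such that $\Gamma-X$ contains no subgraph isomorphic to $G$.
   Context: Graphs may be infinite. A graph is rayless if it contains no ray (one-way infinite path). A subgraph embedding of $H$ into $G$ is an injective map $V(H)\to V(G)$ sending edges to edges. A class $\mathcal C$ of graphs is labelled well-quasi-ordered (lwqo) if for every finite set $L$, the class of all graphs from $\mathcal C$ whose vertices are labelled by elements of $L$ is well-quasi-ordered by label-preserving subgraph embeddings (i.e. every infinite sequence $H_1,H_2,\dots$ of such labelled graphs has $i<j$ with a label-preserving subgraph embedding of $H_i$ into $H_j$). *)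

(* Defs.v *)
From mathcomp Require Import all_boot.
From mathcomp Require Import boolp classical_sets functions cardinality.

Set Implicit Arguments.
Unset Strict Implicit.
Unset Printing Implicit Defensive.

Local Open Scope classical_set_scope.

(* Simple graphs of arbitrary cardinality. *)
Record graph := Graph {
  vertex :> Type;
  adj : vertex -> vertex -> Prop;
  adj_sym : forall x y, adj x y -> adj y x;
  adj_irrefl : forall x, ~ adj x x
}.

Definition isomorphic (G H : graph) : Prop :=
  exists2 f : G -> H, bijective f & forall x y, adj (f x) (f y) <-> adj x y.

Definition is_embedding (H G : graph) (f : H -> G) : Prop :=
  injective f /\ forall x y, adj x y -> adj (f x) (f y).

(* Subgraphs that are not necessarily induced. *)
Record subgraph (G : graph) := Subgraph {
  sub_vertices : set G;
  sub_adj : G -> G -> Prop;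
  sub_adj_sym : forall x y, sub_adj x y -> sub_adj y x;
  sub_adj_vertices : forall x y, sub_adj x y -> sub_vertices x /\ sub_vertices y;
  sub_adj_adj : forall x y, sub_adj x y -> adj x y
}.

Section SubgraphAsGraph.
Variables (G : graph) (S : subgraph G).

Let sadj (x y : sub_vertices S) : Prop := sub_adj S (val x) (val y).

Fact sadj_sym x y : sadj x y -> sadj y x.
Proof. exact: sub_adj_sym. Qed.

Fact sadj_irrefl x : ~ sadj x x.
Proof. by move=> /sub_adj_adj /adj_irrefl. Qed.

Definition graph_of_subgraph : graph := Graph sadj_sym sadj_irrefl.

End SubgraphAsGraph.
Coercion graph_of_subgraph : subgraph >-> graph.

Section Induced.
Variables (G : graph) (A : set G).

Let iadj (x y : A) : Prop := adj (val x) (val y).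

Fact iadj_sym x y : iadj x y -> iadj y x.
Proof. exact: adj_sym. Qed.

Fact iadj_irrefl x : ~ iadj x x.
Proof. exact: adj_irrefl. Qed.

Definition induced : graph := Graph iadj_sym iadj_irrefl.

End Induced.

Definition delete (G : graph) (X : set G) : graph := induced (~` X).

Definition contains (Gamma G : graph) : Prop :=
  exists S : subgraph Gamma, isomorphic G S.

(* The subgraphs form a family indexed by 'I_k, which matters only for the
   empty graph: its unique copy counts as k pairwise disjoint copies. *)
Definition contains_disjoint (k : nat) (Gamma G : graph) : Prop :=
  exists S : 'I_k -> subgraph Gamma,
    (forall i, isomorphic G (S i)) /\
    trivIset [set: 'I_k] (fun i => sub_vertices (S i)).

Section Ray.

Let radj (m n : nat) : Prop := n = m.+1 \/ m = n.+1.

Fact radj_sym m n : radj m n -> radj n m.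
Proof. by case; [right | left]. Qed.

Fact radj_irrefl n : ~ radj n n.
Proof. by case=> /esym/eqP; rewrite (gtn_eqF (ltnSn n)). Qed.

Definition ray : graph := Graph radj_sym radj_irrefl.

End Ray.

Definition rayless (G : graph) : Prop := ~ contains G ray.

(* Classes of graphs are plain predicates because [set] is universe-monomorphic
   and its universe is already that of vertex types. *)
Definition lwqo (C : graph -> Prop) : Prop :=
  forall (L : finType) (H : nat -> graph) (l : forall n, H n -> L),
    (forall n, C (H n)) ->
    exists i j, (i < j)%N /\
      exists2 f : H i -> H j, is_embedding f & forall x, l j (f x) = l i x.

Definition induced_subgraphs (G H : graph) : Prop :=
  exists A : set G, H = induced A.

Definition erdos_posa (G : graph) : Prop :=
  exists f : nat -> nat, forall (Gamma : graph) (k : nat),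
    contains_disjoint k Gamma G \/
    exists X : set Gamma, (X #<= `I_(f k))%card /\ ~ contains (delete X) G.

(* Main.v *)
(** Say that copies of [G] can be rerouted if, for some finite [Y], any finite
    number of copies of [G] in a graph whose images of [Y] are disjoint can be
    replaced by as many disjoint copies.  Then [G] has the Erdos-Posa property
    with [f k = k * |Y|]: pack disjoint images of [Y] greedily; a maximal packing
    with fewer than [k] members meets the image of [Y] in every copy of [G].

    Rerouting rests on self-embeddings of [G].  By labelled well-quasi-ordering,
    the components left after deleting finitely many vertices are, up to
    finitely many of them, partitioned into increasing omega-chains, and
    shifting these chains frees any given finite part of a component.
    Deleting vertices one by one, always inside a component where the property
    fails, would trace a ray; so it holds for [G].  For uncountable [G] the copies
    are rerouted in omega stages, where infinitely many vertices may be placed at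
    once, but only finitely many in each countable class of vertices that can be
    exchanged with one another. *)

From mathcomp Require Import all_boot.
From mathcomp Require Import boolp classical_sets functions cardinality.
From Stdlib Require Import Relation_Operators Operators_Properties.
From Stdlib Require List.
Require Import Defs.

Set Implicit Arguments.
Unset Strict Implicit.
Unset Printing Implicit Defensive.

Local Open Scope classical_set_scope.

(** * Choice, countability and well-quasi-orders *)

Lemma choice_on (T U : Type) (u0 : U) (I : set T) (P : T -> U -> Prop) :
  (forall t, I t -> exists u, P t u) ->
  exists f : T -> U, forall t, I t -> P t (f t).
Proof.
move=> IP; have [f fP] : {f : T -> U & forall t, I t -> P t (f t)}.
  apply: (choice (P := fun t u => I t -> P t u)) => t.
  have [It|nIt] := pselect (I t); last by exists u0.
  by have [u Ptu] := IP t It; exists u.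
by exists f.
Qed.

Lemma dependent_choice (S : Type) (P : nat -> S -> Prop)
    (R : nat -> S -> S -> Prop) (s0 : S) :
  P 0 s0 -> (forall n s, P n s -> exists s', P n.+1 s' /\ R n s s') ->
  exists f : nat -> S, forall n, P n (f n) /\ R n (f n) (f n.+1).
Proof.
move=> P0 step.
have [g gP] := @choice_on (nat * S) S s0 (fun ns => P ns.1 ns.2)
  (fun ns s' => P ns.1.+1 s' /\ R ns.1 ns.2 s') (fun ns => step ns.1 ns.2).
pose f := fix f n := if n is m.+1 then g (m, f m) else s0.
have Pf n : P n (f n) by elim: n => //= n Pn; have [] := gP (n, f n) Pn.
by exists f => n; split=> //; have [] := gP (n, f n) (Pf n).
Qed.

Lemma infinite_seq (T : Type) (A : set T) :
  infinite_set A -> exists s : nat -> T, injective s /\ forall n, A (s n).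
Proof.
move=> Ainf; have [x Ax] : A !=set0 by exact: infinite_setN0.
elim/Ppointed: T => T in A Ainf x Ax *; first by case: (T x).
have /infiniteP/pcard_leP/unsquash f := Ainf.
exists f; split=> [m n|n]; last exact: funS.
by move/(inj (f := f)); apply; rewrite inE.
Qed.

Lemma finite_set_bounded (T : Type) (A : set T) (f : T -> nat) :
  finite_set A -> exists m, forall x, A x -> f x < m.
Proof.
move=> /(finite_image f)/finite_seqP[s fAs]; exists (\max_(i <- s) i).+1 => x Ax.
have fxs : f x \in s.
  have : (f @` A) (f x) by exists x.
  by rewrite fAs.
by rewrite ltnS; exact: leq_bigmax_seq.
Qed.

Lemma countableU (T : Type) (A B : set T) :
  countable A -> countable B -> countable (A `|` B).
Proof.
move=> Ac Bc; rewrite -bigcup2E; apply: bigcup_countable => // -[|[|n]] _ //=.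
Qed.

Lemma subsingleton_countable (T : Type) (A : set T) :
  (forall x y, A x -> A y -> x = y) -> countable A.
Proof.
by move=> AP; apply/countable_injP; exists (fun=> 0) => x y; rewrite !inE => Ax Ay _; exact: AP.
Qed.

Lemma finite_set_inj (T U : Type) (f : T -> U) (A : set T) (B : set U) :
  (forall x y, A x -> A y -> f x = f y -> x = y) -> finite_set B ->
  (forall x, A x -> B (f x)) -> finite_set A.
Proof.
move=> f_inj Bfin AB; have fA : {in A &, injective f}.
  by move=> x y; rewrite !inE; exact: f_inj.
rewrite -(eq_finite_set (inj_card_eq fA)); apply: sub_finite_set Bfin.
by move=> _ [x Ax <-]; exact: AB.
Qed.

(** By induction on [n], only countably many points are reached in [n] steps. *)
Lemma countable_closure (T : Type) (E : T -> T -> Prop) (x : T) :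
  (forall x, countable [set y | E x y]) ->
  countable [set y | clos_refl_trans T E x y].
Proof.
move=> Ecount; pose ball := fix ball n : set T :=
  if n is m.+1 then \bigcup_(y in ball m) [set z | E y z] else [set x].
apply: (@sub_countable _ _ _ (\bigcup_n ball n)).
  apply: subset_card_le => y xy.
  elim: {y xy}(clos_rt_rtn1 _ _ _ _ xy) => [|y z yz _ [n _ ny]].
    by exists 0.
  by exists n.+1 => //; exists y.
apply: bigcup_countable => // n _; elim: n => [|n IH] /=; first exact: countable1.
exact: bigcup_countable.
Qed.

Definition ascending (T : Type) (le : T -> T -> Prop) (A : set T)
    (c : nat -> T) :=
  [/\ forall p, A (c p), injective c & forall p q, p < q -> le (c p) (c q)].

Section WellQuasiOrder.
Variables (T : Type) (le : T -> T -> Prop) (I : set T).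
Hypothesis le_trans : forall y x z, le x y -> le y z -> le x z.
Hypothesis le_wqo : forall s : nat -> T, (forall n, I (s n)) ->
  exists i j, i < j /\ le (s i) (s j).

(** Call an index terminal if no later term lies above its term. Unboundedly many terminal indices
    would form a bad sequence; beyond the last one, larger terms can be picked forever. *)
Lemma wqo_ascending (A : set T) :
  A `<=` I -> infinite_set A -> exists c, ascending le A c.
Proof.
move=> AI /infinite_seq[s [s_inj sA]].
have [N nonterm] : exists N, forall i, N <= i ->
    exists j, i < j /\ le (s i) (s j).
  apply: contrapT => noN.
  have term N : exists i, N <= i /\ forall j, i < j -> ~ le (s i) (s j).
    apply: contrapT => allN; apply: noN; exists N => i Ni.
    apply: contrapT => no_j; apply: allN; exists i; split=> // j ij leij.
    by apply: no_j; exists j.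
  have [f fP] := choice term.
  have [u uP] := @dependent_choice nat
    (fun _ i => forall j, i < j -> ~ le (s i) (s j)) (fun _ i j => i < j)
    (f 0) (fP 0).2 (fun _ i _ => ex_intro _ (f i.+1)
      (conj (fP i.+1).2 (fP i.+1).1)).
  have u_inc : {homo u : i j / i < j} by apply: homo_ltn ltn_trans _ => n; case: (uP n).
  have [i [j [ij]]] := le_wqo (fun n => AI _ (sA (u n))).
  by have [/(_ _ (u_inc _ _ ij))] := uP i.
have [v vP] := @dependent_choice nat (fun _ i => N <= i)
  (fun _ i j => i < j /\ le (s i) (s j)) N (leqnn N) (fun _ i Ni =>
    let: ex_intro j ij := nonterm i Ni in
    ex_intro _ j (conj (leq_trans Ni (ltnW ij.1)) ij)).
have v_inc : {homo v : i j / i < j}.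
  by apply: homo_ltn ltn_trans _ => n; have [_ []] := vP n.
exists (s \o v); split=> [p|p q /s_inj|p q].
- exact: sA.
- have [pq|qp|//] := ltngtP p q => vpq.
  + by have := v_inc _ _ pq; rewrite vpq ltnn.
  + by have := v_inc _ _ qp; rewrite vpq ltnn.
- move: p q; apply: (homo_ltn (r := le) (f := s \o v) le_trans) => n /=.
  by have [_ []] := vP n.
Qed.

(** Zorn's lemma gives a maximal family of disjoint ascending sequences. The set [F] of elements it
    misses is finite, as otherwise it would contain one more such sequence. [ch t] is the chain
    through [t], and [pos t] the position of [t] on it. *)
Lemma wqo_partition : exists (F : set T) (ch : T -> nat -> T) (pos : T -> nat),
  finite_set F /\ forall t, I t -> ~ F t ->
    ch t (pos t) = t /\ forall p,
    [/\ I (ch t p), ~ F (ch t p), ch (ch t p) = ch t & pos (ch t p) = p] /\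
    forall q, p < q -> le (ch t p) (ch t q).
Proof.
pose P (C : set (nat -> T)) := (forall c, C c -> ascending le I c) /\
  forall c c' p q, C c -> C c' -> c p = c' q -> c = c'.
have [C [[Casc Cdisj] Cmax]] : exists C, P C /\ forall D, C `<` D -> ~ P D.
  apply: Zorn_bigcup => F FP Ftot; split=> [c [C FC Cc]|c c' p q].
    exact: (FP _ FC).1.
  move=> [C FC Cc] [D FD Dc']; have [CD|DC] := Ftot _ _ FC FD.
  - exact: (FP _ FD).2 _ _ _ _ (CD _ Cc) Dc'.
  - exact: (FP _ FC).2 _ _ _ _ Cc (DC _ Dc').
pose F := [set t | I t /\ forall c p, C c -> c p <> t].
have [cp cpP] : {cp : T -> (nat -> T) * nat & forall t, I t -> ~ F t ->
    C (cp t).1 /\ (cp t).1 (cp t).2 = t}.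
  apply: (choice (P := fun t cp => I t -> ~ F t -> C cp.1 /\ cp.1 cp.2 = t)).
  move=> t; have [ItnFt|nIt] := pselect (I t /\ ~ F t); last first.
    by exists (fun=> t, 0) => It nFt; case: nIt.
  apply: contrapT => noc; case: ItnFt => It; apply; split=> // c p Cc cpt.
  by apply: noc; exists (c, p).
have Fchain c p : C c -> ~ F (c p) by move=> Cc [_ /(_ c p Cc)].
have cpE c p : C c -> cp (c p) = (c, p).
  move=> Cc; have [Icp c_inj _] := Casc _ Cc.
  have [Cc' cpcp] := cpP (c p) (Icp p) (Fchain _ _ Cc).
  rewrite [LHS]surjective_pairing; have eqc := Cdisj _ _ _ _ Cc' Cc cpcp.
  by rewrite eqc in cpcp *; rewrite (c_inj _ _ cpcp).
exists F, (fun t => (cp t).1), (fun t => (cp t).2); split; last first.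
  move=> t It nFt; have [Cc cpt] := cpP t It nFt; split=> // p.
  have [Ic c_inj c_le] := Casc _ Cc.
  by rewrite cpE //=; split; [split=> //; exact: Fchain|exact: c_le].
apply: contrapT => Finf.
have [c [Fc c_inj c_le]] : exists c, ascending le F c.
  by apply: wqo_ascending => // t [].
have nCc : ~ C c by move=> /Fchain/(_ (Fc 0)).
apply: (Cmax (c |` C)); first by split=> [d|/(_ c (or_introl erefl))//]; right.
split=> [d [->|/Casc//]|d d' p q].
  by split=> // p; case: (Fc p).
move=> [->|Cd] [->|Cd'] // dp; last exact: Cdisj dp.
- by have [_ /(_ d' q Cd')] := Fc p; rewrite dp.
- by have [_ /(_ d p Cd)] := Fc q; rewrite dp.
Qed.

End WellQuasiOrder.

(** * Components *)

Section Components.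
Variable G : graph.
Implicit Types (A B C : set G) (x y z : G) (xs : seq G).

(** Reflexive even outside [A], hence the clause [A y] in [component]. *)
Definition joined A : G -> G -> Prop :=
  clos_refl_trans G (fun x y => [/\ A x, A y & adj x y]).

Definition component A x : set G := [set y | A y /\ joined A x y].

Definition components A : set (set G) := [set component A x | x in A].

Definition connected A := forall x y, A x -> A y -> joined A x y.

Lemma joined_sym A x y : joined A x y -> joined A y x.
Proof.
elim=> [u v [Au Av /adj_sym uv]|u|u v w _ vu _ wv]; first exact: rt_step.
  exact: rt_refl.
exact: rt_trans wv vu.
Qed.

Lemma component_self A x : A x -> component A x x.
Proof. by split=> //; exact: rt_refl. Qed.

Lemma component_eq A x y : component A x y -> component A y = component A x.
Proof.
move=> [_ xy]; apply/seteqP; split=> z [Az] h; split=> //.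
  exact: rt_trans xy h.
by apply: rt_trans h; exact: joined_sym.
Qed.

Lemma componentsE A C x : components A C -> C x -> A x /\ C = component A x.
Proof. by move=> [y Ay <-] yx; split; [case: yx|exact: esym (component_eq yx)]. Qed.

Lemma components_sub A C : components A C -> C `<=` A.
Proof. by move=> AC x /(componentsE AC)[]. Qed.

Lemma adj_component A x y : A x -> A y -> adj x y -> component A y = component A x.
Proof.
by move=> Ax Ay xy; apply: component_eq; split=> //; exact: rt_step.
Qed.

Lemma component_connected A x : A x -> connected (component A x).
Proof.
move=> Ax; have key y : joined A x y -> joined (component A x) x y.
  move=> xy; elim: {y xy}(clos_rt_rtn1 _ _ _ _ xy) => [|u v [Au Av uv] xu IH].
    exact: rt_refl.
  have xu' : joined A x u by exact: clos_rtn1_rt.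
  have xv : joined A x v by apply: rt_trans xu' (rt_step _ _ _ _ _).
  by apply: rt_trans IH (rt_step _ _ _ _ _).
move=> y z [_ /key xy] [_ /key xz].
exact: rt_trans (joined_sym xy) xz.
Qed.

(** The walk is cut just before its first arrival at [x]. *)
Lemma joined_last A x y : joined A y x -> y <> x ->
  exists z, joined (A `\ x) y z /\ adj z x.
Proof.
move=> yx; elim: {y x yx}(clos_rt_rt1n _ _ _ _ yx) => [//|u v w [Au Av uv] vw IH uw].
have [vw_eq|vw_neq] := pselect (v = w).
  by exists u; split; [exact: rt_refl|rewrite -vw_eq].
have [z [vz zw]] := IH vw_neq.
by exists z; split=> //; apply: rt_trans vz; apply: rt_step.
Qed.

(* [xs] lists the deleted vertices; preserving adjacency to them lets the
   embedding be extended by the identity on [xs]. *)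
Definition embeds xs A B (f : G -> G) :=
  [/\ forall x, A x -> B (f x),
      forall x y, A x -> A y -> f x = f y -> x = y,
      forall x y, A x -> A y -> adj x y -> adj (f x) (f y) &
      forall x z, A x -> List.In z xs -> adj x z -> adj (f x) z].

Lemma embeds_comp xs A B C f g :
  embeds xs A B f -> embeds xs B C g -> embeds xs A C (g \o f).
Proof.
move=> [f1 f2 f3 f4] [g1 g2 g3 g4]; split=> /= [x /f1/g1//|x y Ax Ay|x y Ax Ay|x z Ax zxs].
- by move/g2 => /(_ (f1 _ Ax) (f1 _ Ay))/f2; apply.
- by move=> xy; apply: g3; [exact: f1|exact: f1|exact: f3].
- by move=> xz; apply: g4 => //; [exact: f1|exact: f4].
Qed.

Lemma adj_list_eq xs x y :
  [seq `[< adj x z >] | z <- xs] = [seq `[< adj y z >] | z <- xs] ->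
  forall z, List.In z xs -> adj x z -> adj y z.
Proof.
elim: xs => //= u xs IH [xu_yu /IH{}IH] z [<-|/IH//].
by move=> xu; apply/asboolP; rewrite -xu_yu; exact/asboolP.
Qed.

(** Each vertex is labelled by its adjacencies to the finite list [xs], so label-preserving
    embeddings respect these. *)
Lemma lwqo_embeds xs : lwqo (induced_subgraphs G) ->
  forall C : nat -> set G, exists i j,
    i < j /\ exists f, embeds xs (C i) (C j) f.
Proof.
move=> Glwqo C; pose lab (n : nat) (x : induced (C n)) :=
  map_tuple (fun z => `[< adj (val x) z >]) (in_tuple xs).
have [//|i [j [ij [f [f_inj f_adj] f_lab]]]] := Glwqo _ _ lab.
  by move=> n; exists (C n).
exists i, j; split=> //.
pose g (x : G) := if pselect (C i x) is left Cx then
  val (f (exist _ x (mem_set Cx))) else x.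
have gE x (Cx : C i x) : g x = val (f (exist _ x (mem_set Cx))).
  by rewrite /g; case: pselect => // Cx'; congr (val (f (exist _ _ _))).
exists g; split=> [x Cx|x y Cx Cy|x y Cx Cy|x z Cx].
- by rewrite gE; exact: set_valP.
- by rewrite !gE => /val_inj/f_inj [].
- by rewrite !gE => xy; apply: f_adj.
- rewrite gE; apply: adj_list_eq.
  by have /(congr1 (@tval _ _)) /= := f_lab (exist _ x (mem_set Cx)).
Qed.

End Components.

(** * Self-embeddings by shifting chains of components *)

Section Flexible.
Variable G : graph.
Implicit Types (A B C D W Y : set G) (x y z : G) (xs : seq G).
Implicit Types (R : G -> G -> Prop) (rho : G -> nat).

(* [W] is the preimage of what the other copies occupy: the part [Y] is already
   placed, and the copy is to be changed so that [Y'] avoids [W].  Since vertices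
   only move along [R], it suffices that [W] meets every [R]-neighbourhood in a
   finite set. *)
Definition movable xs A R Y Y' := forall W,
  (forall x, finite_set [set y | R x y /\ W y]) ->
  (forall x, Y x -> ~ W x) ->
  exists f, [/\ embeds xs A A f, forall x, Y x -> f x = x,
    forall x, A x -> R x (f x) & forall x, Y' x -> ~ W (f x)].

(* [rho] is a rank imposed by the host graph; the bound [rho x < n] keeps the
   part placed by stage [n] finite in each class of exchangeable vertices. *)
Definition exhausts A Y rho (V : nat -> set G) :=
  [/\ V 0 = Y, forall n, V n `<=` V n.+1, forall n, V n `<=` A,
      forall x, A x -> exists n, V n x &
      forall n x, V n x -> Y x \/ rho x < n].

(** Countable [R]-degree in both directions keeps the classes of exchangeable host vertices
    countable, so that they can be ranked. The exhaustion may depend on [rho], known only once a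
    host graph is given; [R] and [Y] may not. *)
Definition flexible_via xs A R Y :=
  [/\ finite_set Y, forall x y, R x y -> A x /\ A y,
      forall x, countable [set y | R x y \/ R y x] &
      forall rho, exists V, exhausts A Y rho V /\
        forall n, movable xs A R (V n) (V n.+1)].

Definition flexible xs A := exists R Y, flexible_via xs A R Y.

(** The vertex [x] is placed at the start and never moves: since [x] is in the list, the
    self-embeddings of the rest preserve adjacency to [x] and extend by the identity. *)
Lemma flexible_add xs A x : A x -> flexible (x :: xs) (A `\ x) -> flexible xs A.
Proof.
move=> Ax [R [Y [Yfin RA Rcount AV]]].
exists (fun y z => R y z \/ y = x /\ z = x), (x |` Y); split.
- by rewrite finite_setU.
- by move=> y z [/RA[[? _] [? _]]|[-> ->]].
- move=> y; apply: (sub_countable _ (countableU (Rcount y) (countable1 x))).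
  apply: subset_card_le => z /= [[?|[_ ->]]|[?|[->]]]; by [left; left|left; right|right].
move=> rho; have [V [[V0 Vinc VA Vall Vrho] Vmov]] := AV rho.
exists (fun n => x |` V n); split; first split.
- by rewrite V0.
- by move=> n y [->|/Vinc Vy]; [left|right].
- by move=> n y [->//|/VA[]].
- move=> y Ay; have [->|yx] := pselect (y = x); first by exists 0; left.
  by have [|n Vy] := Vall y; [split|exists n; right].
- by move=> n y [->|/Vrho[]]; [left; left|left; right|right].
move=> n W Wthin VW.
have [z|z Vz|f [[f1 f2 f3 f4] fV fR fW]] := Vmov n W.
- by apply: sub_finite_set (Wthin z) => y /= [Rzy Wy]; split=> //; left.
- by apply: VW; right.
pose g y := if pselect (y = x) is left _ then x else f y.
have gx : g x = x by rewrite /g; case: pselect.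
have gE y : y <> x -> g y = f y by rewrite /g; case: pselect.
have AD y : A y -> y <> x -> (A `\ x) y by [].
have fA y : A y -> y <> x -> (A `\ x) (f y) by move=> Ay yx; exact: f1.
exists g; split.
- split=> [y Ay|y z Ay Az|y z Ay Az|y z Ay zxs].
  + by have [->|yx] := pselect (y = x); rewrite ?gx ?gE //; case: (fA y).
  + have [->|yx] := pselect (y = x); have [->|zx] := pselect (z = x); rewrite ?gx ?gE //.
    * by move=> xf; have [_ []] := fA z Az zx; exact: esym.
    * by move=> fx; have [_ []] := fA y Ay yx.
    * by apply: f2; apply: AD.
  + have [->|yx] := pselect (y = x); have [->|zx] := pselect (z = x); rewrite ?gx ?gE //.
    * move=> /adj_sym zx'; apply: adj_sym.
      by apply: f4; [exact: AD|left|].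
    * by move=> yx'; apply: f4; [exact: AD|left|].
    * by apply: f3; apply: AD.
  + by have [->|yx] := pselect (y = x); rewrite ?gx ?gE // => yz; apply: f4; [exact: AD|right|].
- move=> y [->|Vy]; first exact: gx.
  by have [_ yx] := VA _ _ Vy; rewrite gE //; exact: fV.
- move=> y Ay; have [->|yx] := pselect (y = x); first by right.
  by left; rewrite gE //; exact: fR.
- move=> y [->|Vy]; first by rewrite gx; apply: VW; left.
  by have [_ yx] := VA _ _ Vy; rewrite gE //; exact: fW.
Qed.

Section Union.
Variables (xs : seq G) (A : set G).
Hypothesis Glwqo : lwqo (induced_subgraphs G).
Hypothesis Aflex : forall C, components A C -> flexible xs C.

Lemma flexible_components : flexible xs A.
Proof.
pose le C D := exists f, embeds xs C D f.
have le_trans D C E : le C D -> le D E -> le C E.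
  by move=> [f Cf] [g Dg]; exists (g \o f); exact: embeds_comp Cf Dg.
have [F [ch [pos [Ffin chP]]]] := wqo_partition le_trans
  (fun s (_ : forall n, components A (s n)) => lwqo_embeds xs Glwqo s).
(* One embedding is fixed per comparable pair, so that shifts take a vertex to only countably many
   places. *)
have [emb embP] : {emb : set G * set G -> G -> G & forall CD, le CD.1 CD.2 ->
    embeds xs CD.1 CD.2 (emb CD)}.
  apply: (choice (P := fun CD f => le CD.1 CD.2 -> embeds xs CD.1 CD.2 f)) => CD.
  by have [[f Cf]|nle] := pselect (le CD.1 CD.2); [exists f|exists id].
have [RC RCP] := choice_on (fun _ _ => False) Aflex.
have [YC YCP] := choice_on set0 RCP.
have comp_uniq C D x : components A C -> components A D -> C x -> D x -> C = D.
  by move=> AC AD /(componentsE AC)[_ ->] /(componentsE AD)[_ ->].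
have comp_of x : A x -> components A (component A x) by exists x.
pose link x y := exists C q, [/\ components A C, ~ F C, pos C < q, C x &
  y = emb (C, ch C q) x].
pose R x y := (exists2 C, components A C & RC C x y) \/ link x y.
have linkP C q : components A C -> ~ F C -> pos C < q ->
    embeds xs C (ch C q) (emb (C, ch C q)).
  move=> AC nFC pq; apply: (embP (C, ch C q)); have [chC chCP] := chP C AC nFC.
  by have [_ /(_ _ pq)] := chCP (pos C); rewrite chC.
have RA x y : R x y -> A x /\ A y.
  case=> [[C AC RCxy]|[C [q [AC nFC pq Cx ->]]]].
    have [_ RCC _ _] := YCP C AC; have [Cx Cy] := RCC _ _ RCxy.
    by split; exact: components_sub AC _ _.
  split; first exact: components_sub AC _ Cx.
  have [_ /(_ q)[[Ach _ _ _] _]] := chP C AC nFC.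
  by apply: (components_sub Ach); have [+ _ _ _] := linkP C q AC nFC pq; apply.
exists R, (\bigcup_(C in F `&` components A) YC C); split.
- apply: bigcup_finite => [|C [_ AC]]; first exact: finite_setIl.
  by have [] := YCP C AC.
- exact: RA.
(* Neighbours of [x] lie in its own component, or are among its countably many shifts, or are
   shifted onto [x]. By injectivity each [p] gives at most one of the last kind; [S p] demands
   [embeds] because [ch C0 p] need not embed in [C0]. *)
- move=> x; pose C0 := component A x.
  pose S p := [set z | [/\ ch C0 p z, embeds xs (ch C0 p) C0 (emb (ch C0 p, C0))
    & emb (ch C0 p, C0) z = x]].
  have [Ax|nAx] := pselect (A x); last first.
    by apply: subsingleton_countable => y z [/RA[]//|/RA[]].
  have [_ _ /(_ x) countC _] := YCP _ (comp_of _ Ax).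
  have countE : countable (range (fun q => emb (C0, ch C0 q) x)).
    by apply: sub_countable (card_image_le _ _) _.
  have countS : countable (\bigcup_p S p).
    apply: bigcup_countable => // p _; apply: subsingleton_countable.
    by move=> y z [py [_ inj _ _] yx] [pz _ zx]; apply: inj; rewrite // yx.
  apply: (sub_countable _ (countableU countC (countableU countE countS))).
  apply: subset_card_le => y [[[C AC xy]|[C [q [AC nFC pq Cx ->]]]]|[[C AC yx]|[C [q [AC nFC pq Cy xE]]]]].
  + have [_ /(_ _ _ xy)[Cx _] _ _] := YCP _ AC.
    by left; left; rewrite /C0; have [_ <-] := componentsE AC Cx.
  + by right; left; exists q => //; rewrite /C0; have [_ <-] := componentsE AC Cx.
  + have [_ /(_ _ _ yx)[_ Cx] _ _] := YCP _ AC.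
    by left; right; rewrite /C0; have [_ <-] := componentsE AC Cx.
  + right; right; exists (pos C) => //.
    have [chC /(_ q)[[Ach nFch chch _] _]] := chP C AC nFC.
    have emC := linkP C q AC nFC pq; have [/(_ _ Cy) chx _ _ _] := emC.
    rewrite -xE in chx; have [_ C0E] := componentsE Ach chx.
    by rewrite /S /= /C0 -C0E chch chC.
move=> rho.
have [VC VCP] := choice_on (fun=> set0) (fun C AC => let: And4 _ _ _ h := YCP C AC in h rho).
have [mx mxP] := choice_on 0 (fun C AC =>
  let: And4 h _ _ _ := YCP C AC in finite_set_bounded rho h).
(* The component [C] is placed from stage [act C] on, starting with the finite
   set [YC C]; those in [F] belong to no chain and are placed at once. *)
pose act C := if pselect (F C) is left _ then 0 else (maxn (pos C) (mx C)).+1.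
have actF C : F C -> act C = 0 by rewrite /act; case: pselect.
(* Waiting for [pos C] keeps the number of placed components in each chain finite at every stage;
   waiting for [mx C], which exceeds all ranks on [YC C], gives the rank condition of [exhausts]. *)
have actNF C : ~ F C -> act C = (maxn (pos C) (mx C)).+1.
  by rewrite /act; case: pselect.
pose V n := [set x | [/\ A x, act (component A x) <= n &
  VC (component A x) (n - act (component A x)) x]].
have VC0 C : components A C -> VC C 0 = YC C by move=> /VCP[[]].
exists V; split; first split.
- apply/seteqP; split=> [x [Ax]|x [C [FC AC]]].
    rewrite leqn0 /act; case: pselect => // FC _; rewrite subnn VC0; last exact: comp_of.
    by move=> Yx; exists (component A x) => //; split=> //; exact: comp_of.
  rewrite -VC0 // => Vx; have Cx : C x by have [[_ _ VCC _ _] _] := VCP C AC; exact: VCC Vx.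
  have [Ax CE] := componentsE AC Cx.
  by split; rewrite -?CE ?actF.
- move=> n x [Ax actn Vx]; split=> //; first exact: leqW.
  rewrite subSn //; have [[_ Vinc _ _ _] _] := VCP _ (comp_of x Ax); exact: Vinc.
- by move=> n x [].
- move=> x Ax; have [[_ _ _ Vall _] _] := VCP _ (comp_of x Ax).
  have [n Vn] := Vall x (component_self Ax).
  by exists (act (component A x) + n); split; rewrite ?leq_addr // addKn.
- move=> n x [Ax actn Vx]; have AC := comp_of x Ax.
  have [[_ _ _ _ /(_ _ _ Vx)[Yx|rx]] _] := VCP _ AC; last first.
    by right; apply: leq_trans rx (leq_subr _ _).
  have [FC|nFC] := pselect (F (component A x)).
    by left; exists (component A x).
  right; apply: leq_trans (mxP _ AC x Yx) (leq_trans _ actn).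
  by rewrite actNF // ltnW // ltnS leq_maxr.
move=> n W Wthin VW.
have chain_pos C p : components A C -> ~ F C -> act (ch C p) <= n -> p < n.
  move=> AC nFC; have [_ /(_ p)[[_ nFch _ posch] _]] := chP C AC nFC.
  by rewrite actNF // posch; apply: leq_trans; rewrite ltnS leq_maxl.
(* Components already placed are changed from inside; in each chain [c] the
   others are shifted by [K c], chosen so large that the sets [YC] entering at
   stage [n.+1] avoid [W]. *)
have inner C : components A C /\ act C <= n -> exists f,
    [/\ embeds xs C C f, forall x, VC C (n - act C) x -> f x = x,
      forall x, C x -> RC C x (f x) &
      forall x, VC C (n.+1 - act C) x -> ~ W (f x)].
  move=> [AC actn]; have [[_ _ VCC _ _] Vmov] := VCP C AC.
  rewrite subSn //; apply: Vmov => [x|x Vx].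
    apply: sub_finite_set (Wthin x) => y [xy Wy]; split=> //.
    by left; exists C.
  by have [Ax CE] := componentsE AC (VCC _ _ Vx); apply: VW; split; rewrite -?CE.
have [f fP] := choice_on id inner.
have shift c : (exists C, [/\ components A C, ~ F C & ch C = c]) -> exists k,
    n < k /\ forall p x, p <= n -> YC (c p) x -> ~ W (emb (c p, c (p + k)) x).
  move=> [C [AC nFC chC]].
  have [_ chCP] := chP C AC nFC.
  pose bad p := \bigcup_(x in YC (c p))
    [set k | 0 < k /\ W (emb (c p, c (p + k)) x)].
  have cA p : components A (c p) by have [[]] := chCP p; rewrite chC.
  have cF p : ~ F (c p) by have [[]] := chCP p; rewrite chC.
  have cc p : ch (c p) = c by have [[]] := chCP p; rewrite chC.
  have cpos p : pos (c p) = p by have [[]] := chCP p; rewrite chC.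
  have c_inj p q x : c p x -> c q x -> p = q.
    by move=> px qx; rewrite -(cpos p) -(cpos q) (comp_uniq _ _ _ (cA p) (cA q) px qx).
  have badfin p : finite_set (bad p).
    have [Yfin _ _ _] := YCP _ (cA p).
    apply: bigcup_finite => // x Yx.
    have cpx : c p x.
      by have [[V0 _ VCC _ _] _] := VCP _ (cA p); apply: (VCC 0); rewrite V0.
    have lk k : 0 < k -> embeds xs (c p) (c (p + k)) (emb (c p, c (p + k))).
      move=> k0; have := linkP (c p) (p + k) (cA p) (cF p); rewrite cc; apply.
      by rewrite cpos -[X in X < _]addn0 ltn_add2l.
    (* [g] recovers the shift from the image: different shifts of [x] land in different components,
       and only finitely many images of [x] lie in [W]. *)
    pose g y := if pselect (exists k, c (p + k) y) is left e then projT1 (cid e) else 0.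
    apply: sub_finite_set (finite_image g (Wthin x)) => k [k0 Wk].
    exists (emb (c p, c (p + k)) x).
      split=> //; right; exists (c p), (p + k); split=> //; last by rewrite cc.
      by rewrite cpos -[X in X < _]addn0 ltn_add2l.
    have [/(_ _ cpx) ck _ _ _] := lk k k0.
    rewrite /g; case: pselect => [e|[]]; last by exists k.
    by case: (cid e) => k' /= ck'; apply/(@addnI p)/(c_inj _ _ _ ck' ck).
  have [m mP] := finite_set_bounded id (bigcup_finite (finite_II n.+1) (fun p _ => badfin p)).
  (* Exceeding [n] makes the shift land on components not yet placed; exceeding [m] avoids all bad
     shifts from positions up to [n]. *)
  exists (maxn n m).+1; split; first by rewrite ltnS leq_maxl.
  move=> p x pn Yx Wx; have : (maxn n m).+1 < m.
    by apply: mP; exists p => //; exists x.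
  by rewrite ltnNge leqW // leq_maxr.
have [K KP] := choice_on 0 shift.
pose tgt C := ch C (pos C + K (ch C)).
pose g x := let C := component A x in
  if act C <= n then f C x else emb (C, tgt C) x.
have tgtP C : components A C -> ~ act C <= n ->
    [/\ ~ F C, components A (tgt C), ~ act (tgt C) <= n,
      embeds xs C (tgt C) (emb (C, tgt C)) & pos C < pos C + K (ch C)].
  move=> AC actC; have nFC : ~ F C by move=> FC; apply: actC; rewrite actF.
  have [nK _] := KP _ (ex_intro _ C (And3 AC nFC erefl)).
  have posK : pos C < pos C + K (ch C).
    by rewrite -[X in X < _]addn0 ltn_add2l (leq_trans _ nK).
  have [_ /(_ (pos C + K (ch C)))[[Atgt nFtgt _ _] _]] := chP C AC nFC.
  split=> //; last exact: linkP.
  move=> /(chain_pos _ _ AC nFC); rewrite ltnNge => /negP; apply.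
  exact: leq_trans (ltnW nK) (leq_addl _ _).
have gC x : A x -> let C := component A x in
    (if act C <= n then C else tgt C) (g x).
  move=> Ax; rewrite /g /=; case: ifPn => [actn|/negP actn].
    by have [[fC _ _ _] _ _ _] := fP _ (conj (comp_of x Ax) actn); exact/fC/component_self.
  by have [_ _ _ [eC _ _ _] _] := tgtP _ (comp_of x Ax) actn; exact/eC/component_self.
have gemb C : components A C -> exists D, embeds xs C D g.
  move=> AC; have gE x : C x -> g x = if act C <= n then f C x else emb (C, tgt C) x.
    by move=> Cx; have [Ax CE] := componentsE AC Cx; rewrite /g /= -CE.
  exists (if act C <= n then C else tgt C).
  move: gE; case: ifPn => [actn|/negP actn] gE.
    have [[f1 f2 f3 f4] _ _ _] := fP _ (conj AC actn).
    by split=> [x Cx|x y Cx Cy|x y Cx Cy|x z Cx]; rewrite !gE //; auto.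
  have [_ _ _ [f1 f2 f3 f4] _] := tgtP _ AC actn.
  by split=> [x Cx|x y Cx Cy|x y Cx Cy|x z Cx]; rewrite !gE //; auto.
exists g; split.
- split=> [x Ax|x y Ax Ay gxy|x y Ax Ay xy|x z Ax zxs xz].
  + have /= := gC x Ax; case: ifPn => [_|/negP actn]; apply: components_sub; first exact: comp_of.
    by have [_ Atgt _ _ _] := tgtP _ (comp_of x Ax) actn.
  + have [D [_ + _ _]] := gemb _ (comp_of x Ax).
    apply=> //; first exact: component_self.
    suff -> : component A x = component A y by exact: component_self.
    move: (gC x Ax) (gC y Ay); rewrite gxy /=.
    have [ACx ACy] := (comp_of x Ax, comp_of y Ay).
    (* Placed components stay and the others move to unplaced ones, so the mixed cases are
       impossible. Two shifted components with one target share the chain, hence the shift, hence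
       the position. *)
    case: ifPn => [actx|/negP actx] gx; case: ifPn => [acty|/negP acty] gy.
    * exact: comp_uniq gx gy.
    * have [_ At nact _ _] := tgtP _ ACy acty.
      by case: nact; rewrite (comp_uniq _ _ _ At ACx gy gx).
    * have [_ At nact _ _] := tgtP _ ACx actx.
      by case: nact; rewrite (comp_uniq _ _ _ At ACy gx gy).
    * have [nFx Atx _ _ _] := tgtP _ ACx actx.
      have [nFy Aty _ _ _] := tgtP _ ACy acty.
      have eqt := comp_uniq _ _ _ Atx Aty gx gy.
      have [chx /(_ (pos (component A x) + K (ch (component A x))))[[_ _ chtx postx] _]] := chP _ ACx nFx.
      have [chy /(_ (pos (component A y) + K (ch (component A y))))[[_ _ chty posty] _]] := chP _ ACy nFy.
      have eqch : ch (component A x) = ch (component A y) by rewrite -chtx -chty -/(tgt _) eqt.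
      rewrite -chx -chy -eqch; congr (ch _ _).
      apply: (@addIn (K (ch (component A x)))).
      by rewrite -postx {3}eqch -posty -/(tgt _) eqt.
  + have [D [_ _ + _]] := gemb _ (comp_of x Ax); apply=> //; first exact: component_self.
    by rewrite -(adj_component Ax Ay xy); exact: component_self.
  + have [D [_ _ _ +]] := gemb _ (comp_of x Ax); apply=> //; exact: component_self.
- move=> x [Ax actn Vx]; rewrite /g /= actn.
  by have [_ -> //] := fP _ (conj (comp_of x Ax) actn).
- move=> x Ax; have AC := comp_of x Ax; rewrite /g /=; case: ifPn => [actn|/negP actn].
    have [_ _ fR _] := fP _ (conj AC actn).
    by left; exists (component A x) => //; exact/fR/component_self.
  have [nFC _ _ _ posK] := tgtP _ AC actn.
  right; exists (component A x), (pos (component A x) + K (ch (component A x))).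
  by split=> //; exact: component_self.
- move=> x [Ax actn1 Vx]; have AC := comp_of x Ax; rewrite /g /=; case: ifPn => [actn|/negP actn].
    by have [_ _ _ fW] := fP _ (conj AC actn); exact: fW.
  (* The component enters exactly now, so only its initial set [YC] has to avoid [W], which the
     choice of [K] ensures. *)
  have actE : act (component A x) = n.+1.
    by apply/eqP; rewrite eqn_leq actn1 ltnNge; exact/negP.
  have [nFC _ _ _ _] := tgtP _ AC actn.
  have [_ KC] := KP _ (ex_intro _ (component A x) (And3 AC nFC erefl)).
  have posn : pos (component A x) <= n.
    by move: actE; rewrite actNF // => -[<-]; exact: leq_maxl.
  have [chC _] := chP _ AC nFC.
  have := KC (pos (component A x)) x posn; rewrite chC; apply.
  by rewrite -VC0 // -(subnn n.+1) -{2}actE.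
Qed.

End Union.
End Flexible.

(** * Copies as embeddings, and flexibility of rayless graphs *)

(** The subgraph receives only the images of edges of [H], so that the isomorphism also reflects
    adjacency. *)
Lemma embedding_subgraph (H Gamma : graph) (h : H -> Gamma) :
  is_embedding h ->
  exists S : subgraph Gamma, isomorphic H S /\ sub_vertices S = range h.
Proof.
move=> [h_inj h_adj].
pose e u v := exists x y, [/\ adj x y, h x = u & h y = v].
have e_sym u v : e u v -> e v u.
  by move=> [x [y [xy xu yv]]]; exists y, x; split=> //; exact: adj_sym.
have e_range u v : e u v -> range h u /\ range h v.
  by move=> [x [y [_ xu yv]]]; split; [exists x|exists y].
have e_adj u v : e u v -> adj u v.
  by move=> [x [y [xy <- <-]]]; exact: h_adj.
pose S := Subgraph e_sym e_range e_adj.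
exists S; split=> //.
have h_range x : h x \in range h by apply: mem_set; exists x.
have hK (s : S) : exists x, h x = val s by have [x _ <-] := set_valP s; exists x.
have [g gP] := choice hK.
exists (fun x => exist _ (h x) (h_range x) : S).
  exists g => [x|s]; first by apply: h_inj; rewrite gP.
  by apply: val_inj; rewrite /= gP.
move=> x y; split=> [[x' [y' [xy /= /h_inj <- /h_inj <-]]] //|xy].
by exists x, y.
Qed.

Lemma embedding_contains (H Gamma : graph) (h : H -> Gamma) :
  is_embedding h -> contains Gamma H.
Proof. by move=> /embedding_subgraph[S [HS _]]; exists S. Qed.

Lemma delete_contains (H Gamma : graph) (X : set Gamma) :
  contains (delete X) H -> exists h : H -> Gamma, is_embedding h /\
    forall x, ~ X (h x).
Proof.
move=> [S [f [g fK _] f_adj]]; exists (fun x => val (val (f x))); split.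
  split=> [x y /val_inj/val_inj/(can_inj fK)//|x y xy].
  have /sub_adj_adj : sub_adj S (val (f x)) (val (f y)) by exact/f_adj.
  by [].
by move=> x; exact: (set_valP (val (f x))).
Qed.

(** A state is a connected set that is not flexible, the list of deleted vertices, and a vertex [x]
    of the set. After deleting [x] some component is still not flexible, and by connectedness it
    contains a neighbour of [x], the next vertex. The sets shrink past each chosen vertex, so the
    vertices form a ray. *)
Lemma rayless_flexible (G : graph) :
  rayless G -> lwqo (induced_subgraphs G) -> flexible (G := G) [::] setT.
Proof.
move=> Gray Glwqo; apply: contrapT => nflex; apply: Gray.
pose st := (set G * seq G * G)%type.
pose bad (s : st) := [/\ connected s.1.1, s.1.1 s.2 & ~ flexible s.1.2 s.1.1].
have bad_component xs (A : set G) : ~ flexible xs A ->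
    exists B, [/\ components A B, connected B & ~ flexible xs B].
  move=> nflexA; apply: contrapT => noB; apply: nflexA.
  apply: flexible_components => // B AB; apply: contrapT => nflexB.
  apply: noB; exists B; split=> //.
  by have [x Ax <-] := AB; exact: component_connected.
have [B0 [[x0 _ B0E] B0con nflexB0]] := bad_component _ _ nflex.
have bad0 : bad (B0, [::], x0).
  by split=> //=; rewrite -B0E; exact: component_self.
pose next (s s' : st) := adj s.2 s'.2 /\ s'.1.1 `<=` s.1.1 `\ s.2.
have step s : bad s -> exists s', bad s' /\ next s s'.
  case: s => [[A xs] x] [/= Acon Ax nflexA].
  have nflexAx : ~ flexible (x :: xs) (A `\ x) by move=> /(flexible_add Ax).
  have [B [AB Bcon nflexB]] := bad_component _ _ nflexAx.
  have [y [Ay yx] BE] := AB.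
  have [z [yz zx]] := joined_last (Acon _ _ Ay Ax) yx.
  have Bz : B z.
    rewrite -BE; split=> //.
    by case: {yz zx}(clos_rt_rtn1 _ _ _ _ yz) => // u v [].
  exists (B, x :: xs, z); split; first by split.
  by split; [exact: adj_sym|exact: components_sub AB].
have [s sP] := @dependent_choice st (fun=> bad) (fun=> next) _ bad0 (fun _ => step).
have sub m n : m <= n -> (s n).1.1 `<=` (s m).1.1.
  elim: n => [|n IH]; first by rewrite leqn0 => /eqP->.
  rewrite leq_eqVlt => /predU1P[->//|mn] x.
  by have [_ [_ h]] := sP n; move=> /h[/(IH mn)].
have neq m n : m < n -> (s m).2 <> (s n).2.
  move=> mn eq_mn; have [[_ sn _] _] := sP n.
  have [_ [_ h]] := sP m; have [_] := h _ (sub _ _ mn _ sn).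
  by apply; exact: esym.
apply: (@embedding_contains ray G (fun n => (s n).2)); split=> [m n mn|m n].
  by have [/neq//|/neq[]|//] := ltngtP m n; exact: esym.
by move=> [->|->]; [|apply: adj_sym]; [have [_ []] := sP m|have [_ []] := sP n].
Qed.

(** * Making copies disjoint *)

Section Uncrossing.
Variables (G Gamma : graph) (R : G -> G -> Prop) (Y : set G).
Hypothesis Gflex : flexible_via [::] setT R Y.
Variables (k : nat) (g : 'I_k -> G -> Gamma).
Hypothesis g_emb : forall i, is_embedding (g i).
Hypothesis g_disj : forall i j x y, Y x -> Y y -> g i x = g j y -> i = j.

(** A single exchange inside one of the copies; the classes [K] collect repeated exchanges, which
    may pass from copy to copy. *)
Let E u v := exists i x y, [/\ R x y \/ R y x, g i x = u & g i y = v].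
Let K u : set Gamma := [set v | clos_refl_trans Gamma E u v].

Let g_inj i : injective (g i). Proof. by have [] := g_emb i. Qed.

Let K_sym u v : K u v -> K v u.
Proof.
elim=> [a b [i [x [y [xy xa yb]]]]|a|a b c _ ba _ cb].
- by apply: rt_step; exists i, y, x; split=> //; case: xy; [right|left].
- exact: rt_refl.
- exact: rt_trans cb ba.
Qed.

Let K_countable u : countable (K u).
Proof.
apply: countable_closure => {}u.
pose S i := [set v | exists x y, [/\ R x y \/ R y x, g i x = u & g i y = v]].
apply: (@sub_countable _ _ _ (\bigcup_i S i)).
  by apply: subset_card_le => v [i h]; exists i.
apply: bigcup_countable => // i _.
have [[x gx]|nox] := pselect (exists x, g i x = u); last first.
  by apply: subsingleton_countable => v w [x [y [_ gx _]]]; case: nox; exists x.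
have [_ _ /(_ x) Rcount _] := Gflex.
apply: sub_countable (sub_countable (card_image_le (g i) _) Rcount).
apply: subset_card_le => v [x' [y [xy gx' <-]]]; exists y => //.
by have <- : x' = x by apply: (@g_inj i); rewrite gx.
Qed.

(** Each countable class is numbered injectively; indexing the numberings by the class as a set
    makes its members share one. *)
Let exists_rank : exists rho : Gamma -> nat,
  forall u n, finite_set [set v | K u v /\ rho v < n].
Proof.
have [r rP] : {r : set Gamma -> Gamma -> nat & forall B, countable B ->
    {in B &, injective (r B)}}.
  apply: (choice (P := fun B r => countable B -> {in B &, injective r})) => B.
  have [/countable_injP[r rB]|nB] := pselect (countable B); first by exists r.
  by exists (fun=> 0) => /nB.
exists (fun v => r (K v) v) => u n.
apply: (@finite_set_inj _ _ (r (K u)) _ `I_n) => [v w [uv _] [uw _]||v [uv]] /=.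
- by apply: rP; rewrite ?inE.
- exact: finite_II.
suff -> : K v = K u by [].
apply/seteqP; split=> w h; first exact: rt_trans uv h.
by apply: rt_trans h; exact: K_sym.
Qed.

(** In each round every copy is changed so that its next part avoids the placed parts of the others.
    Placed vertices never move again, so a limit exists; any two vertices are placed by a common
    stage, where injectivity, adjacency and disjointness can be read off. *)
Lemma uncrossing : exists h : 'I_k -> G -> Gamma,
  (forall i, is_embedding (h i)) /\
  forall i j x y, h i x = h j y -> i = j.
Proof.
have [rho rhoP] := exists_rank.
have [Yfin _ _ Vex] := Gflex.
have [V VP] := choice (fun i => Vex (rho \o g i)).
(* Copies advance one at a time, so each has its own stage [t i]. Vertices stay in their classes
   throughout. *)
pose inv (s : 'I_k -> G -> G) (t : 'I_k -> nat) :=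
  [/\ forall i, embeds [::] setT setT (s i),
      forall i x, K (g i x) (g i (s i x)) &
      forall i j x y, V i (t i) x -> V j (t j) y ->
        g i (s i x) = g j (s j y) -> i = j].
pose agree (t : 'I_k -> nat) (s s' : 'I_k -> G -> G) :=
  forall i x, V i (t i) x -> s' i x = s i x.
have step1 s t i : inv s t -> exists s',
    inv s' (fun j => t j + (i == j)) /\ agree t s s'.
  move=> [s_emb s_K s_disj].
  pose W := [set x | exists j y, [/\ j <> i, V j (t j) y & g i (s i x) = g j (s j y)]].
  have s_inj j : injective (s j) by move=> x y; have [_ + _ _] := s_emb j; apply.
  (* Neighbours of [x] along [R] land in the class of [g i x]. There a copy [j] has placed only
     finitely many vertices: they come from [Y] or from vertices of rank below [t j]. *)
  have Wthin x : finite_set [set y | R x y /\ W y].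
    pose B j := [set z | K (g i x) (g j (s j z)) /\ V j (t j) z].
    apply: (@finite_set_inj _ _ (g i \o s i) _
      (\bigcup_(j in [set: 'I_k]) ((g j \o s j) @` B j))).
    - by move=> y z _ _ /g_inj/s_inj.
    - apply: bigcup_finite => // j _; apply: finite_image.
      have [[_ _ _ _ Vrho] _] := VP j.
      have Dfin : finite_set [set z | K (g i x) (g j z) /\ rho (g j z) < t j].
        apply: (@finite_set_inj _ _ (g j) _ _ _ (rhoP (g i x) (t j))) => [y z _ _ /g_inj//|//].
      have YDfin : finite_set (Y `|` [set z | K (g i x) (g j z) /\ rho (g j z) < t j]).
        by rewrite finite_setU.
      apply: sub_finite_set YDfin => z [Kz /Vrho[|rz]]; [by left|right; split=> //].
      by apply: rt_trans Kz _; apply: K_sym.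
    - move=> y [Rxy [j [z [_ Vz eyz]]]]; exists j => //; exists z => //; split=> //.
      rewrite -eyz; apply: rt_trans (s_K i y).
      by apply: rt_step; exists i, x, y; split=> //; left.
  have VW x : V i (t i) x -> ~ W x.
    by move=> Vx [j [y [ji Vy exy]]]; apply: ji; apply: esym; exact: s_disj exy.
  have [_ Vmov] := VP i; have [f [f_emb fV fR fW]] := Vmov (t i) W Wthin VW.
  pose s' j := if i == j then s j \o f else s j.
  exists s'; split; last first.
    by move=> j x; rewrite /s'; case: eqVneq => // <- Vx /=; rewrite fV.
  have key j x y : j <> i -> V i (t i + 1) x -> V j (t j) y ->
      g i (s i (f x)) = g j (s j y) -> False.
    by rewrite addn1 => ji Vx Vy exy; apply: (fW x Vx); exists j, y.
  split=> [j|j x|j l x y]; rewrite /s'.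
  - by case: eqVneq => // <-; exact: embeds_comp f_emb (s_emb i).
  - case: eqVneq => // <- /=; apply: rt_trans (s_K i (f x)).
    by apply: rt_step; exists i, x, (f x); split=> //; left; exact: fR.
  - case: eqVneq => [<-|/eqP ij]; case: eqVneq => [<-//|/eqP il]; rewrite ?addn0 /=.
    + by move=> Vx Vy exy; case: (key l x y) => //; exact: nesym.
    + by move=> Vx Vy exy; case: (key j y x) => //; exact: nesym.
    + exact: s_disj.
(* Each copy advances by its multiplicity in [l]; the enumeration of all copies thus advances each
   by one. *)
have steps l s t : inv s t -> exists s',
    inv s' (fun j => t j + count_mem j l) /\ agree t s s'.
  elim: l s t => [|i l IH] s t inv_s.
    exists s; split=> //; suff -> : (fun j => t j + count_mem j [::]) = t by [].
    by apply/funext => j; rewrite addn0.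
  have [s1 [/IH[s2 [inv2 agree2]] agree1]] := step1 _ _ i inv_s.
  exists s2; split; last first.
    move=> j x Vx; rewrite agree2 ?agree1 //; have [[_ Vinc _ _ _] _] := VP j.
    by case: (i == j); rewrite ?addn0 // addn1; exact: Vinc.
  suff <- : (fun j => t j + (i == j) + count_mem j l) =
      (fun j => t j + count_mem j (i :: l)) by [].
  by apply/funext => j; rewrite -addnA.
have step n s : inv s (fun=> n) -> exists s',
    inv s' (fun=> n.+1) /\ agree (fun=> n) s s'.
  move=> /(steps (enum 'I_k))[s' [inv' agree']]; exists s'; split=> //.
  suff <- : (fun j => n + count_mem j (enum 'I_k)) = (fun=> n.+1) by [].
  by apply/funext => j; rewrite count_uniq_mem ?enum_uniq // mem_enum addn1.
have inv0 : inv (fun=> id) (fun=> 0).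
  split=> [i|i x|i j x y]; first by split.
  - exact: rt_refl.
  - by have [[-> _ _ _ _] _] := VP i; have [[-> _ _ _ _] _] := VP j; exact: g_disj.
have [s sP] := dependent_choice inv0 step.
have Vmono i : {homo V i : m n / m <= n >-> m `<=` n}.
  apply: (homo_leq (r := subset)) => [A|B A C AB BC|n]; first exact: subset_refl.
    exact: subset_trans BC.
  by have [[_ + _ _ _] _] := VP i; apply.
have s_stable i x m n : m <= n -> V i m x -> s n i x = s m i x.
  elim: n => [|n IH]; first by rewrite leqn0 => /eqP->.
  rewrite leq_eqVlt => /predU1P[->//|mn] Vx; rewrite -IH //.
  by have [_ /(_ i x)] := sP n; apply; exact: Vmono Vx.
have Vcover (ix : 'I_k * G) : exists n, V ix.1 n ix.2.
  by have [[_ _ _ + _] _] := VP ix.1; apply.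
have [N NP] := choice Vcover.
have common i j x y : exists n, [/\ V i n x, V j n y,
    s (N (i, x)) i x = s n i x & s (N (j, y)) j y = s n j y].
  have [Vx Vy] := (NP (i, x), NP (j, y)).
  exists (maxn (N (i, x)) (N (j, y))); split.
  - exact: Vmono (leq_maxl _ _) _ Vx.
  - exact: Vmono (leq_maxr _ _) _ Vy.
  - by rewrite [RHS](s_stable _ _ _ _ (leq_maxl _ _) Vx).
  - by rewrite [RHS](s_stable _ _ _ _ (leq_maxr _ _) Vy).
exists (fun i x => g i (s (N (i, x)) i x)); split=> [i|i j x y].
  split=> x y; have [n [_ _ -> ->]] := common i i x y;
    have [[/(_ i)[_ s_inj s_adj _] _ _] _] := sP n.
  - by move/g_inj/s_inj; apply.
  - by move=> xy; have [_ + ] := g_emb i; apply; exact: s_adj.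
have [n [Vx Vy -> ->]] := common i j x y.
have [[_ _ + ] _] := sP n; exact.
Qed.

End Uncrossing.

(** * Greedy packing and the Erdős-Pósa bound *)

(** Quotient and remainder modulo the size of [Y] encode a copy and an element of [Y]. Here [m]
    precedes the host, so the bound depends on [G] and [k] only. *)
Lemma bigcup_image_card (T : Type) (Y : set T) : finite_set Y ->
  exists m, forall (U : Type) (g : nat -> T -> U) k,
    (\bigcup_(i in `I_k) (g i @` Y) #<= `I_(k * m))%card.
Proof.
have [->|/set0P[x0 _]] := eqVneq Y set0.
  move=> _; exists 0 => U g k; rewrite bigcup0 ?card_ge0 // => i _.
  by rewrite image_set0.
move=> /(@finite_seqP {classic T})[s ->]; exists (size s) => U g k.
pose F j := g (j %/ size s) (nth (x0 : {classic T}) s (j %% size s)).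
apply: card_le_trans (card_image_le F `I_(k * size s)).
apply: subset_card_le => _ [i /= ik [x /= xs <-]].
have x_lt : index (x : {classic T}) s < size s by rewrite index_mem.
exists (i * size s + index (x : {classic T}) s) => /=.
  by apply: leq_trans (_ : i.+1 * size s <= _); [rewrite mulSnr ltn_add2l|rewrite leq_mul2r ik orbT].
by rewrite /F divnMDl ?(leq_trans _ x_lt) // divn_small // addn0 modnMDl modn_small // nth_index.
Qed.

Section Packing.
Variables (G Gamma : graph) (Y : set G) (h0 : G -> Gamma).

(** A packing either meets the image of [Y] in every copy or can be enlarged by a copy it misses.
    The map [h0] only fills the values of the empty packing. *)
Lemma packing k :
  (exists g : nat -> G -> Gamma, (forall i, i < k -> is_embedding (g i)) /\
    forall i j x y, i < k -> j < k -> Y x -> Y y -> g i x = g j y -> i = j) \/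
  exists g : nat -> G -> Gamma,
    forall h : G -> Gamma, is_embedding h ->
      exists2 x, Y x & (\bigcup_(i in `I_k) (g i @` Y)) (h x).
Proof.
elim: k => [|k [[g [g_emb g_disj]]|[g g_hit]]]; last 1 first.
- right; exists g => // h /g_hit[x Yx [i ik gix]].
  by exists x => //; exists i => //; exact: leqW.
- by left; exists (fun=> h0).
have [hit|] := pselect (forall h : G -> Gamma, is_embedding h ->
    exists2 x, Y x & (\bigcup_(i in `I_k) (g i @` Y)) (h x)).
  right; exists g => // h /hit[x Yx [i ik gix]].
  by exists x => //; exists i => //; exact: leqW.
move=> /existsNP[h /not_implyP[h_emb nhit]]; left.
have hg i x y : i < k -> Y x -> Y y -> g i x <> h y.
  by move=> ik Yx Yy gh; apply: nhit; exists y => //; exists i => //; exists x.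
exists (fun i => if i < k then g i else h); split=> [i _|i j x y].
  by case: ifP => // ik; exact: g_emb.
rewrite !ltnS => ik jk Yx Yy.
case: ltnP => ki; case: ltnP => kj.
- exact: g_disj.
- by move/(hg _ _ _ ki Yx Yy).
- by move/esym/(hg _ _ _ kj Yy Yx).
- by move=> _; apply/eqP; rewrite eqn_leq (leq_trans ik kj) (leq_trans jk ki).
Qed.

End Packing.

Theorem theorem1p4 (G : graph) (hray : rayless G)
    (hlwqo : lwqo (induced_subgraphs G)) :
  erdos_posa G.
Proof.
have [R [Y Gflex]] := rayless_flexible hray hlwqo.
have [Yfin _ _ _] := Gflex; have [m mP] := bigcup_image_card Yfin.
exists (fun k => k * m) => Gamma k.
(* Without any copy the empty set suffices; otherwise some copy serves as the default [h0]. *)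
have [[h0 h0_emb]|noh] := pselect (exists h : G -> Gamma, is_embedding h); last first.
  right; exists set0; split; first exact: card_ge0.
  by move=> /delete_contains[h [h_emb _]]; apply: noh; exists h.
have [[g [g_emb g_disj]]|[g g_hit]] := packing Y h0 k; last first.
  right; exists (\bigcup_(i in `I_k) (g i @` Y)); split; first exact: mP.
  by move=> /delete_contains[h [/g_hit[x _ Xhx] /(_ x)]].
left; have [i|i j x y Yx Yy gxy|h [h_emb h_disj]] :=
    @uncrossing G Gamma R Y Gflex k (fun i => g i).
- exact: g_emb.
- exact/val_inj/(g_disj _ _ _ _ _ _ Yx Yy gxy).
have [S SP] := choice (fun i => embedding_subgraph (h_emb i)).
exists S; split=> [i|i j _ _ [u [Siu Sju]]]; first by have [] := SP i.
move: Siu Sju; have [_ ->] := SP i; have [_ ->] := SP j.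
by move=> [x _ <-] [y _ /esym/h_disj].
Qed.
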